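(* Let $n,a,b\ge 1$ be integers and consider the weight game $W(a,b)$ played on the path $P_n$ with $n$ vertices. The number $N_{LR}$ of legal positions with exactly two pieces, one Left and one Right, is $$N_{LR}=\begin{cases} 0 & \text{if } a+b>n,\\ 2\binom{n-a-b+2}{2} & \text{if } a+b\le n.\end{cases}$$ The numbers $N_{LL}$ and $N_{RR}$ of legal positions consisting of exactly two Left pieces, respectively exactly two Right pieces, are $$N_{LL}=\begin{cases} 0 & \text{if } 2a>n,\\ \binom{n-2a+2}{2} & \text{if } 2a\le n,\end{cases}\qquad N_{RR}=\begin{cases} 0 & \text{if } 2b>n,\\ \binom{n-2b+2}{2} & \text{if } 2b\le n.\end{cases}$$ Moreover, the number $f_2$ of faces with two vertices of the legal complex of this game satisfies $$f_2=N_{LR}+N_{LL}+N_{RR}.$$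
   Context: The weight game $W(a,b)$ on a graph $B$ (the board) is the following two-player game. Starting with the empty board, Left places pieces of weight $a$ and Right places pieces of weight $b$; a piece of weight $w$ covers a connected set of $w$ vertices (inducing a connected subgraph of $B$), all of which must be empty when the piece is placed. Pieces are never moved or removed, and there are no further rules. Left and Right pieces are distinguishable by owner, even when $a=b$. A position is a set of pieces on the board. It is legal exactly when the pieces cover pairwise disjoint vertex sets; order of play is irrelevant, and moves need not alternate. On the path $P_n$ a piece of weight $w$ covers $w$ consecutive vertices. The legal complex is the simplicial complex whose faces are the legal positions (vertices are the legal one-piece positions), and $f_i$ denotes the number of faces with $i$ vertices, i.e. of legal positions with exactly $i$ pieces. *)

(* Defs.v *)
From HB Require Import structures.
From mathcomp Require Import all_boot.

Set Implicit Arguments.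
Unset Strict Implicit.
Unset Printing Implicit Defensive.

Record graph := Graph {
  vertex :> finType;
  adj : rel vertex;
  adj_sym : symmetric adj;
  adj_irrefl : irreflexive adj
}.

Definition induced_adj (B : graph) (A : {set B}) : rel B :=
  fun u v => [&& u \in A, v \in A & adj u v].

Definition connected_set (B : graph) (A : {set B}) : bool :=
  (A != set0) && [forall x in A, forall y in A, connect (induced_adj A) x y].

Definition path_adj (n : nat) : rel 'I_n :=
  fun i j => (i.+1 == j :> nat) || (j.+1 == i :> nat).

Lemma path_adj_sym n : symmetric (@path_adj n).
Proof. by move=> i j; rewrite /path_adj orbC. Qed.

Lemma path_adj_irrefl n : irreflexive (@path_adj n).
Proof. by move=> i; rewrite /path_adj orbb -[X in _ == X]addn0 -addn1 eqn_add2l. Qed.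

Definition path_graph (n : nat) : graph :=
  Graph (@path_adj_sym n) (@path_adj_irrefl n).

(* The vertices of a complex are the [x : T] with [[set x]] a face; elements
   of [T] that lie in no face are not vertices. *)
Record simplicial_complex (T : finType) := SimplicialComplex {
  faces : {set {set T}};
  faces0 : set0 \in faces;
  facesS : forall F G : {set T}, F \in faces -> G \subset F -> G \in faces
}.

(* Indexed by the number of vertices of the faces, not by their dimension. *)
Definition f_number (T : finType) (K : simplicial_complex T) (i : nat) : nat :=
  #|[set F in faces K | #|F| == i]|.

Inductive player := Left | Right.

Definition bool_of_player (p : player) : bool := if p is Left then true else false.
Definition player_of_bool (c : bool) : player := if c then Left else Right.

Lemma bool_of_playerK : cancel bool_of_player player_of_bool.
Proof. by case. Qed.

HB.instance Definition _ := Finite.copy player (can_type bool_of_playerK).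

(* A piece is its owner together with the vertex set it covers, so Left and
   Right pieces on the same set are distinct even when [a = b]. *)
Definition piece (B : graph) : finType := (player * {set B})%type.
Definition owner (B : graph) (p : piece B) : player := p.1.
Definition covered (B : graph) (p : piece B) : {set B} := p.2.

Definition weight (a b : nat) (p : player) : nat := if p is Left then a else b.

Definition legal_piece (a b : nat) (B : graph) (p : piece B) : bool :=
  (#|covered p| == weight a b (owner p)) && connected_set (covered p).

Definition legal_position (a b : nat) (B : graph) (P : {set piece B}) : bool :=
  [forall p in P, legal_piece a b p] &&
  [forall p in P, forall q in P, (p != q) ==> [disjoint covered p & covered q]].

Definition legal_positions (a b : nat) (B : graph) : {set {set piece B}} :=
  [set P | legal_position a b P].

Lemma legal_positions0 a b (B : graph) : set0 \in legal_positions a b B.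
Proof. by rewrite inE; apply/andP; split; apply/forall_inP=> p; rewrite inE. Qed.

Lemma legal_positionsS a b (B : graph) (P Q : {set piece B}) :
  P \in legal_positions a b B -> Q \subset P -> Q \in legal_positions a b B.
Proof.
rewrite !inE => /andP[/forall_inP legP /forall_inP disP] /subsetP QP.
apply/andP; split; apply/forall_inP => p Qp; first exact: legP (QP p Qp).
apply/forall_inP => q Qq.
by have /forall_inP := disP p (QP p Qp); apply; apply: QP.
Qed.

Definition legal_complex (a b : nat) (B : graph) : simplicial_complex (piece B) :=
  SimplicialComplex (@legal_positions0 a b B) (@legal_positionsS a b B).

Definition pieces_of (B : graph) (c : player) (P : {set piece B}) : {set piece B} :=
  [set p in P | owner p == c].

Definition num_legal (a b : nat) (B : graph) (l r : nat) : nat :=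
  #|[set P in legal_positions a b B |
      (#|pieces_of Left P| == l) && (#|pieces_of Right P| == r)]|.

Definition N_LR (a b : nat) (B : graph) : nat := num_legal a b B 1 1.
Definition N_LL (a b : nat) (B : graph) : nat := num_legal a b B 2 0.
Definition N_RR (a b : nat) (B : graph) : nat := num_legal a b B 0 2.

(* Main.v *)
Require Import Defs.
From mathcomp Require Import all_boot.
From mathcomp Require Import zify.

Set Implicit Arguments.
Unset Strict Implicit.
Unset Printing Implicit Defensive.

(* A piece of weight w on P_n is an interval [i, i + w), so a two-piece position
   is determined by the owners c, d of the left and of the right interval
   together with their starting points i, j, where i + w_c <= j and
   j + w_d <= n.  For fixed owners there are
   \sum_(j <= n - w_d) (j + 1 - w_c) = 'C(n - w_c - w_d + 2, 2) of these. *)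

(** * Intervals as the connected sets of a path *)

Definition seg (n i w : nat) : {set 'I_n} := [set x : 'I_n | i <= x < i + w].

Lemma card_seg n i w : i + w <= n -> #|seg n i w| = w.
Proof.
move=> le_n.
have lt_n (k : 'I_w) : i + k < n by have := ltn_ord k; lia.
have inj : injective (fun k : 'I_w => Ordinal (lt_n k)).
  by move=> k l /(congr1 val) /= /addnI /val_inj.
rewrite -[RHS]card_ord -cardsT -(card_imset _ inj); congr #|pred_of_set _|.
apply/setP=> x; rewrite inE; apply/idP/imsetP => [xi | [k _ ->] /=]; last first.
  by have := ltn_ord k; lia.
have lt_w : x - i < w by lia.
by exists (Ordinal lt_w) => //; apply: val_inj => /=; lia.
Qed.

Lemma induced_adj_sym (B : graph) (A : {set B}) : symmetric (induced_adj A).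
Proof. by move=> u v; rewrite /induced_adj adj_sym andbCA. Qed.

(** If [z] were missing from [A], no edge inside [A] could jump over it, since edges join
    consecutive vertices. The vertices below [z] would then be closed under [induced_adj A],
    separating [x] from [y]. *)
Lemma connected_path_convex n (A : {set path_graph n}) (x y z : 'I_n) :
  connected_set A -> x \in A -> y \in A -> x <= z <= y -> z \in A.
Proof.
case/andP=> _ /forall_inP conA xA yA /andP[xz zy].
have /forall_inP/(_ y yA) := conA x xA; apply: contraLR => zA.
have nxz : x != z by apply: contraNneq zA => <-.
have nyz : y != z by apply: contraNneq zA => <-.
have ltxz : x < z by rewrite ltn_neqAle nxz.
have clz : closed (induced_adj A) [pred u : 'I_n | u < z].
  move=> u v /and3P[uA vA] /orP adjuv; rewrite !inE.
  have nuz : val u != val z by apply: contraNneq zA => /val_inj <-.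
  have nvz : val v != val z by apply: contraNneq zA => /val_inj <-.
  by case: adjuv => /eqP /= e; apply/idP/idP; move: nuz nvz => /=; lia.
apply/negP => /(closed_connect clz); rewrite !inE ltxz => /esym.
by rewrite ltnNge zy.
Qed.

Lemma seg_connected n i w :
  i + w <= n -> 0 < w -> connected_set (seg n i w : {set path_graph n}).
Proof.
move=> le_n w0; apply/andP; split.
  by rewrite -card_gt0 card_seg.
have lt_i : i < n by lia.
(* Every vertex is reached from the left end, by induction on its distance [k]; two arbitrary
   vertices are then joined through that end by symmetry. *)
have con0 k (x : path_graph n) : x = i + k :> nat -> x \in seg n i w ->
    connect (induced_adj (seg n i w : {set path_graph n})) (Ordinal lt_i) x.
  elim: k x => [|k IHk] x ex xs.
    suff -> : x = Ordinal lt_i by exact: connect0.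
    by apply: val_inj; rewrite /= ex addn0.
  have lt_k : i + k < n by have := ltn_ord x; lia.
  have ks : Ordinal lt_k \in seg n i w by move: xs; rewrite !inE /=; lia.
  apply: connect_trans (IHk (Ordinal lt_k) erefl ks) (connect1 _).
  by apply/and3P; split=> //; apply/orP; left; rewrite /= ex addnS.
apply/forall_inP=> x xs; apply/forall_inP=> y ys.
have sub z : z \in seg n i w -> z = i + (z - i) :> nat.
  by rewrite inE; lia.
apply: connect_trans (con0 _ y (sub y ys) ys).
rewrite (sym_connect_sym (induced_adj_sym _)); apply: con0 (sub x xs) xs.
Qed.

(** By convexity, [A] fills everything between its least element [i] and its greatest element
    [k]. *)
Lemma connected_path_seg n (A : {set path_graph n}) :
  connected_set A -> exists2 i, i + #|A| <= n & A = seg n i #|A|.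
Proof.
move=> conA; have /andP[/set0Pn[x0 x0A] _] := conA.
case: (@arg_minnP 'I_n x0 (mem A) val x0A) => i iA mini.
case: (@arg_maxnP 'I_n x0 (mem A) val x0A) => k kA maxk.
have ik : i <= k by exact: mini.
have eA : A = seg n i (k.+1 - i).
  apply/setP=> z; rewrite inE; apply/idP/idP => [zA | zi].
    by have := mini z zA; have := maxk z zA; rewrite /=; lia.
  by apply: (connected_path_convex conA iA kA); lia.
have le_n : i + (k.+1 - i) <= n by have := ltn_ord k; lia.
have cA : #|A| = k.+1 - i by rewrite eA card_seg.
by exists i; rewrite cA.
Qed.

(** Since [0 < w], each start lies in its own interval, hence in the other one, so neither start is
    smaller. *)
Lemma seg_inj n i j w :
  0 < w -> i < n -> j < n -> seg n i w = seg n j w -> i = j.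
Proof.
move=> w0 lt_i lt_j /setP e.
have := e (Ordinal lt_i); have := e (Ordinal lt_j); rewrite !inE /=; lia.
Qed.

Lemma disjoint_seg n i j v w : 0 < v -> 0 < w -> i + v <= n -> j + w <= n ->
  [disjoint seg n i v & seg n j w] = (i + v <= j) || (j + w <= i).
Proof.
move=> v0 w0 le_i le_j; apply/idP/idP => [dis | sep].
  (* The larger of the two starts is the witness: it would lie in both intervals if they
     overlapped. *)
  have lt_m : maxn i j < n by lia.
  have := disjointFr dis (x := Ordinal lt_m); rewrite !inE /=; lia.
by apply/pred0P=> x /=; rewrite !inE; lia.
Qed.

(** * Counting the starting points of ordered disjoint intervals *)

Lemma sum_subSn k x : \sum_(j < k) (j.+1 - x) = 'C(k.+1 - x, 2).
Proof.
elim: k => [|k IHk]; first by rewrite big_ord0; case: x => [|x].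
rewrite big_ord_recr /= IHk.
(* Pascal's rule needs [x <= k.+1]; for larger [x] truncated subtraction makes every term vanish. *)
case: (leqP x k.+1) => xk; last by rewrite !bin_small; lia.
by rewrite [in RHS]subSn // binS bin1 addnC.
Qed.

Definition seg_starts (n x y : nat) : {set 'I_n * 'I_n} :=
  [set ij : 'I_n * 'I_n | (ij.1 + x <= ij.2) && (ij.2 + y <= n)].

Lemma card_seg_starts n x y : 0 < x -> 0 < y ->
  #|seg_starts n x y| = if n < x + y then 0 else 'C(n - x - y + 2, 2).
Proof.
move=> x0 y0.
have -> : #|seg_starts n x y| = \sum_(j < n | j + y <= n) (j.+1 - x).
  rewrite -sum1_card.
  transitivity (\sum_(ij : 'I_n * 'I_n | (ij.1 + x <= ij.2) && (ij.2 + y <= n)) 1).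
    by apply: eq_bigl => ij; rewrite inE.
  rewrite -(pair_big_dep xpredT (fun i j : 'I_n => (i + x <= j) && (j + y <= n)) (fun _ _ => 1)) /=.
  rewrite (exchange_big_dep (fun j : 'I_n => j + y <= n)) /=; last by move=> i j _ /andP[].
  apply: eq_bigr => j jn; rewrite sum1_card.
  (* For fixed [j] the admissible [i] form the initial interval of length [j.+1 - x]. *)
  rewrite -[RHS](@card_seg n 0); last by have := ltn_ord j; lia.
  by apply: eq_card => i; rewrite !inE unfold_in; lia.
case: (leqP y n) => yn; last first.
  by rewrite ifT ?big_pred0 //; [move=> j; lia | lia].
have le_k : (n - y).+1 <= n by lia.
have -> : \sum_(j < n | j + y <= n) (j.+1 - x) = \sum_(j < (n - y).+1) (j.+1 - x).
  rewrite (big_ord_widen _ (fun j => j.+1 - x) le_k).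
  by apply: eq_bigl => j; lia.
(* If [n < x + y], the upper index [(n - y).+2 - x] is at most 1. The truncated [n - x - y + 2]
   would be 2 and give 1, hence the separate case. *)
rewrite sum_subSn; case: ifP => nxy; first by rewrite bin_small //; lia.
by congr 'C(_, 2); lia.
Qed.

Lemma set2_inj (T : finType) (p q p' q' : T) : p != q ->
  [set p; q] = [set p'; q'] -> (p = p' /\ q = q') \/ (p = q' /\ q = p').
Proof.
move=> npq /setP e; move: (e p) (e q); rewrite !inE !eqxx orbT /=.
move=> /esym/orP[] /eqP ep /esym/orP[] /eqP eq; [|by left|by right|];
  by move: npq; rewrite ep eq eqxx.
Qed.

Lemma big_player (F : player -> nat) : \sum_c F c = F Left + F Right.
Proof.
rewrite (bigD1 Left) //= (bigD1 Right) //= big1 ?addn0 //.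
by case.
Qed.

(** The four tests are spelled out so that they compute once [Q] is a concrete condition on
    owners. *)
Lemma big_player_pair (Q : pred (player * player)) F :
  \sum_(cd | Q cd) F cd =
    (if Q (Left, Left) then F (Left, Left) else 0)
    + (if Q (Left, Right) then F (Left, Right) else 0)
    + ((if Q (Right, Left) then F (Right, Left) else 0)
       + (if Q (Right, Right) then F (Right, Right) else 0)).
Proof.
rewrite big_mkcond /=.
transitivity (\sum_c \sum_d if Q (c, d) then F (c, d) else 0).
  by rewrite pair_bigA; apply: eq_bigr => -[].
by rewrite !big_player.
Qed.

(** * Two-piece positions and their codes *)

Section TwoPieces.

Variables n a b : nat.
Hypotheses (a_gt0 : 0 < a) (b_gt0 : 0 < b).

Local Notation B := (path_graph n).
Local Notation wt := (weight a b).

Definition seg_piece (c : player) (i : nat) : piece B := (c, seg n i (wt c)).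

Definition seg_pair (u : (player * player) * ('I_n * 'I_n)) : {set piece B} :=
  [set seg_piece u.1.1 u.2.1; seg_piece u.1.2 u.2.2].

(** Owners and starts are both listed from left to right, which gives each legal two-piece position
    exactly one code. *)
Definition seg_codes : {set (player * player) * ('I_n * 'I_n)} :=
  [set u | u.2 \in seg_starts n (wt u.1.1) (wt u.1.2)].

Lemma weight_gt0 c : 0 < wt c.
Proof. by case: c. Qed.

Lemma legal_pieceP (p : piece B) :
  reflect (exists2 i, i + wt (owner p) <= n & p = seg_piece (owner p) i)
          (legal_piece a b p).
Proof.
case: p => c A; rewrite /legal_piece /owner /covered /=.
apply: (iffP andP) => [[/eqP cA conA] | [i le_n [->]]].
  by have [i le_n eA] := connected_path_seg conA; exists i; rewrite /seg_piece -cA -?eA.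
by rewrite card_seg // seg_connected ?weight_gt0.
Qed.

Lemma seg_piece_inj c d (i j : 'I_n) :
  seg_piece c i = seg_piece d j -> c = d /\ i = j.
Proof.
case=> <- /seg_inj e; split=> //; apply: val_inj.
by apply: e; rewrite ?weight_gt0 ?ltn_ord.
Qed.

Lemma seg_codes_neq u : u \in seg_codes ->
  seg_piece u.1.1 u.2.1 != seg_piece u.1.2 u.2.2.
Proof.
case: u => -[c d] [i j]; rewrite !inE /= => /andP[lt12 _].
by apply/eqP => /seg_piece_inj[_ e]; move: lt12; rewrite e; have := weight_gt0 c; lia.
Qed.

(** Two codes of one position agree or are swapped; a swap would put each piece strictly to the left
    of the other. *)
Lemma seg_pair_inj : {in seg_codes &, injective seg_pair}.
Proof.
move=> [[c d] [i j]] [[c' d'] [i' j']] uU vU.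
case/(set2_inj (seg_codes_neq uU)) => -[/= /seg_piece_inj[-> ei] /seg_piece_inj[-> ej]].
  by rewrite ei ej.
move: uU vU; rewrite !inE /= ei ej.
have := weight_gt0 c; have := weight_gt0 c'; lia.
Qed.

Lemma legal_pairsE :
  [set P in legal_positions a b B | #|P| == 2] = seg_pair @: seg_codes.
Proof.
apply/setP=> P; rewrite !inE; apply/andP/imsetP; last first.
  case=> -[[c d] [i j]] uU ->; have npq := seg_codes_neq uU.
  rewrite cards2 npq; split=> //.
  move: uU npq; rewrite !inE /= => /andP[ij jn] npq.
  have wc := weight_gt0 c; have wd := weight_gt0 d.
  apply/andP; split.
    apply/forall_inP=> p; rewrite !inE => /orP[] /eqP ->; apply/legal_pieceP.
      by exists i => //=; rewrite /owner /=; lia.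
    by exists j.
  have dis : [disjoint seg n i (wt c) & seg n j (wt d)].
    by rewrite disjoint_seg ?ij //; lia.
  apply/forall_inP=> p; rewrite !inE => /orP[] /eqP ->;
    apply/forall_inP=> q; rewrite !inE => /orP[] /eqP ->;
    rewrite ?eqxx //= /covered /= ?dis ?implybT //.
  by rewrite disjoint_sym dis implybT.
case=> /andP[/forall_inP leg /forall_inP dis] /cards2P[p [q [npq eP]]].
have pP : p \in P by rewrite eP !inE eqxx.
have qP : q \in P by rewrite eP !inE eqxx orbT.
have {dis} := dis p pP => /forall_inP/(_ q qP); rewrite npq /=.
have /legal_pieceP[i le_i ep] := leg p pP.
have /legal_pieceP[j le_j eq] := leg q qP.
have wp := weight_gt0 (owner p); have wq := weight_gt0 (owner q).
have lt_i : i < n by lia.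
have lt_j : j < n by lia.
(* Disjointness tells which of [p] and [q] is on the left, and the code lists that piece first. *)
rewrite {1}ep {1}eq /covered /= disjoint_seg // => /orP[] sep.
  exists ((owner p, owner q), (Ordinal lt_i, Ordinal lt_j)).
    by rewrite !inE /= sep.
  by rewrite eP {1}ep {1}eq.
exists ((owner q, owner p), (Ordinal lt_j, Ordinal lt_i)).
  by rewrite !inE /= sep.
by rewrite eP setUC {1}ep {1}eq.
Qed.

Lemma card_pieces_of (P : {set piece B}) :
  #|P| = #|pieces_of Left P| + #|pieces_of Right P|.
Proof.
rewrite -(cardsID [set p : piece B | owner p == Left] P).
by congr (_ + _); apply: eq_card => -[c A]; rewrite !inE andbC // /owner; case: c.
Qed.

Lemma card_pieces_of_pair c u : u \in seg_codes ->
  #|pieces_of c (seg_pair u)| = (u.1.1 == c) + (u.1.2 == c).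
Proof.
move=> uU; rewrite -sum1_card.
under eq_bigl do rewrite inE.
rewrite big_mkcondr big_setU1 ?inE ?seg_codes_neq //= big_set1.
by rewrite /owner /=; do 2!case: eqP.
Qed.

(** As [l + r = 2], the counted positions have two pieces, so they correspond to codes. Their owner
    counts depend only on the owner pair, by which the codes are grouped. *)
Lemma num_legal_codes l r : l + r = 2 ->
  num_legal a b B l r =
    \sum_(cd : player * player |
            ((cd.1 == Left) + (cd.2 == Left) == l)
            && ((cd.1 == Right) + (cd.2 == Right) == r))
       #|seg_starts n (wt cd.1) (wt cd.2)|.
Proof.
move=> lr2.
pose Q (cd : player * player) := ((cd.1 == Left) + (cd.2 == Left) == l)
            && ((cd.1 == Right) + (cd.2 == Right) == r).
have -> : num_legal a b B l r = #|seg_pair @: [set u in seg_codes | Q u.1]|.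
  apply: eq_card => P; rewrite inE; apply/andP/imsetP.
    case=> legP /andP[eL eR].
    have : P \in seg_pair @: seg_codes.
      by rewrite -legal_pairsE inE legP card_pieces_of (eqP eL) (eqP eR) lr2 eqxx.
    case/imsetP=> u uU eP; exists u => //.
    by rewrite inE uU /Q -!card_pieces_of_pair // -eP eL eR.
  case=> u; rewrite inE => /andP[uU Qu] eP.
  have : P \in seg_pair @: seg_codes by rewrite eP imset_f.
  rewrite -legal_pairsE inE => /andP[-> _].
  by rewrite eP !card_pieces_of_pair.
rewrite card_in_imset; last first.
  by move=> u v; rewrite inE [v \in _]inE => /andP[uU _] /andP[vU _]; apply: seg_pair_inj.
rewrite -sum1_card.
under [RHS]eq_bigr do rewrite -sum1_card.
rewrite pair_big_dep /=; apply: eq_bigl => -[cd ij].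
by rewrite 3!inE andbC.
Qed.

Lemma f_number2E : f_number (legal_complex a b B) 2 =
  N_LR a b B + N_LL a b B + N_RR a b B.
Proof.
rewrite /f_number /N_LR /N_LL /N_RR /num_legal -!sum1_card.
rewrite big_mkcond [X in _ = X + _ + _]big_mkcond [X in _ = _ + X + _]big_mkcond.
rewrite [X in _ = _ + X]big_mkcond -!big_split /=; apply: eq_bigr => P _; rewrite !inE card_pieces_of.
case: (legal_position a b P) => //=.
(* A total of 2 splits only as 1 + 1, 2 + 0 or 0 + 2, so exactly one indicator on the right
   fires. *)
by case: #|pieces_of Left P| => [|[|[|l]]]; case: #|pieces_of Right P| => [|[|[|r]]].
Qed.

End TwoPieces.

Theorem proposition4p2 (n a b : nat) (hn : 1 <= n) (ha : 1 <= a) (hb : 1 <= b) :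
  [/\ N_LR a b (path_graph n) =
        (if n < a + b then 0 else 2 * 'C(n - a - b + 2, 2)),
      N_LL a b (path_graph n) =
        (if n < 2 * a then 0 else 'C(n - 2 * a + 2, 2)),
      N_RR a b (path_graph n) =
        (if n < 2 * b then 0 else 'C(n - 2 * b + 2, 2))
    & f_number (legal_complex a b (path_graph n)) 2 =
        N_LR a b (path_graph n) + N_LL a b (path_graph n)
          + N_RR a b (path_graph n)].
Proof.
split; last exact: f_number2E.
(* Either owner may be on the left; the two orders contribute equal binomials, whence the factor
   2. *)
- rewrite /N_LR num_legal_codes // big_player_pair /= !card_seg_starts //.
  rewrite [b + a]addnC (subnAC n b a); case: ifP => _; lia.
- rewrite /N_LL num_legal_codes // big_player_pair /= !card_seg_starts //.
  by rewrite mul2n -addnn subnDA !addn0.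
- rewrite /N_RR num_legal_codes // big_player_pair /= !card_seg_starts //.
  by rewrite mul2n -addnn subnDA !add0n.
Qed.
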